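(* The map $\mathcal{R}\circ\mathcal{S}^{11}$ is an involution on $\mathcal{C}$. Moreover, $\mathcal{S}^{11}$ is a length-preserving bijection on $\mathcal{C}$. Consequently, for every $n$, the number of $11$-sortable Cayley permutations of length $n$ equals the number of Cayley permutations of length $n$ avoiding $231$.
   Context: A Cayley permutation is a finite word $\pi=\pi_1\cdots\pi_n$ over the positive integers such that every integer from $1$ to $\max(\pi)$ occurs at least once; $\mathcal{C}$ is the set of all Cayley permutations. A word contains a pattern $p=p_1\cdots p_k$ if it has a subsequence $x_{i_1}\cdots x_{i_k}$ with $x_{i_u}<x_{i_v}$ iff $p_u<p_v$ and $x_{i_u}=x_{i_v}$ iff $p_u=p_v$; otherwise it avoids $p$. $\mathcal{R}$ is the reverse map, $\mathcal{R}(\pi_1\cdots\pi_n)=\pi_n\cdots\pi_1$. For a Cayley permutation $\tau$ of length at least two, a $\tau$-stack processes an input word from left to right with the following right-greedy algorithm: while the input is nonempty, if pushing the next input element onto the stack yields stack contents which, read from top to bottom, avoid $\tau$, the element is pushed; otherwise the top element is popped and appended to the output. When the input is exhausted, the remaining elements are popped one by one. $\mathcal{S}^{\tau}(\pi)$ denotes the output of the $\tau$-stack on input $\pi$. The $11$-machine consists of an $11$-stack followed in series by a $21$-stack (its input is $\mathcal{S}^{11}(\pi)$); $\pi$ is $11$-sortable if the final output of the $11$-machine is weakly increasing. *)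

(* Defs.v *)
From HB Require Import structures.
From mathcomp Require Import all_boot.

Set Implicit Arguments.
Unset Strict Implicit.
Unset Printing Implicit Defensive.

(* Words over the positive integers are represented in [seq nat]; the empty
   word (with maximum 0) is the unique Cayley permutation of length 0. *)
Definition cayley : {pred seq nat} :=
  [pred w : seq nat | all (leq 1) w
                   && all (mem w) (iota 1 (\max_(x <- w) x))].

Definition order_iso (p s : seq nat) : bool :=
  (size s == size p) &&
  all (fun u => all (fun v =>
         ((nth 0 s u < nth 0 s v) == (nth 0 p u < nth 0 p v))
      && ((nth 0 s u == nth 0 s v) == (nth 0 p u == nth 0 p v)))
    (iota 0 (size p))) (iota 0 (size p)).

Definition contains (p w : seq nat) : bool :=
  [exists m : (size w).-tuple bool, order_iso p (mask m w)].

Definition avoids (p w : seq nat) : bool := ~~ contains p w.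

(* A stack is the list of its elements from top to bottom.  [pop_until tau x st]
   performs the pops that precede the push of [x]: it returns the popped
   elements, in order of popping, and the remaining stack.  For patterns of
   length at least two the push onto the empty stack is always allowed, so the
   first test already succeeds when [st] is empty. *)
Fixpoint pop_until (tau : seq nat) (x : nat) (st : seq nat) :
    seq nat * seq nat :=
  if avoids tau (x :: st) then ([::], st)
  else if st is y :: st' then
    let: (out, rest) := pop_until tau x st' in (y :: out, rest)
  else ([::], [::]).

(* Output produced from the current stack [st] and the remaining input. *)
Fixpoint stack_run (tau st input : seq nat) : seq nat :=
  if input is x :: input' then
    let: (out, rest) := pop_until tau x st in
    out ++ stack_run tau (x :: rest) input'
  else st.

Definition tau_stack (tau w : seq nat) : seq nat := stack_run tau [::] w.

Definition sortable11 (w : seq nat) : bool :=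
  sorted leq (tau_stack [:: 2; 1] (tau_stack [:: 1; 1] w)).

(* The letters of a Cayley permutation are bounded by its length, so those of
   length n are exactly the Cayley words among the tuples over {0, ..., n}. *)
Lemma cayley_letter_le_size (w : seq nat) (x : nat) :
  w \in cayley -> x \in w -> x <= size w.
Proof.
case/andP => _ /allP hw xw.
have /leq_trans : x <= \max_(y <- w) y by rewrite (big_rem x) //= leq_maxl.
apply; rewrite -[X in X <= _](size_iota 1); apply: uniq_leq_size hw.
exact: iota_uniq.
Qed.

Definition cayley_count (n : nat) (P : pred (seq nat)) : nat :=
  #|[set w : n.-tuple 'I_n.+1 |
      (map val w \in cayley) && P (map val w)]|.

(* Main.v *)
Require Import Defs.
From HB Require Import structures.
From mathcomp Require Import all_boot.

(** If [w = m C m D] then the stack holds only [m] after reading the second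
    displayed [m], whence [S^11 (m C m D) = S^11 (m C) S^11 (m D)]; if moreover
    [m] does not occur in [B], then [m] stays at the bottom of the stack and
    [S^11 (m B) = S^11 (B) m].  Cutting a word before every occurrence of its
    first letter, these two rules show by induction on the length that
    [R o S^11] is an involution; since [S^11] permutes the letters of its input,
    it acts bijectively on Cayley permutations.  Finally, as in Knuth's theorem,
    the [21]-stack sorts exactly the words avoiding [231], so that [S^11] maps
    the [11]-sortable words onto those avoiding [231]. *)

(** * Pattern containment for 11, 21 and 231 *)

Lemma containsP (p w : seq nat) :
  reflect (exists2 s, subseq s w & order_iso p s) (contains p w).
Proof.
apply: (iffP existsP) => [[m iso_m]|[s /subseqP[m szm ->] iso_s]].
  by exists (mask m w) => //; apply: mask_subseq.
by exists (tcast szm (in_tuple m)); rewrite val_tcast.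
Qed.

Lemma avoids11E (w : seq nat) : avoids [:: 1; 1] w = uniq w.
Proof.
apply/idP/idP; last first.
  move=> uw; apply/containsP => -[[|a [|b [|c s]]] //].
  move=> /subseq_uniq/(_ uw) /=; rewrite inE andbT => neq_ab.
  by rewrite /order_iso /= (negPf neq_ab) /= !andbF.
elim: w => //= x w IHw; apply: contraR; rewrite negb_and negbK => /orP[xw|].
  apply/containsP; exists [:: x; x]; first by rewrite /= eqxx sub1seq.
  by rewrite /order_iso /= eqxx ltnn.
move/(contra IHw); rewrite negbK => /containsP[s sw iso_s].
by apply/containsP; exists s => //; apply: subseq_trans (subseq_cons w x).
Qed.

Lemma avoids21E (w : seq nat) : avoids [:: 2; 1] w = sorted leq w.
Proof.
apply/idP/idP; last first.
  move=> uw; apply/containsP => -[[|a [|b [|c s]]] //].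
  move=> /(subseq_sorted leq_trans)/(_ uw) /=; rewrite andbT => le_ab.
  by rewrite /order_iso /= [b < a]ltnNge le_ab /= !andbF.
elim: w => //= x w IHw; apply: contraR.
rewrite (path_sortedE leq_trans) negb_and => /orP[/allPn[y yw]|].
  rewrite -ltnNge => lt_yx.
  apply/containsP; exists [:: x; y]; first by rewrite /= eqxx sub1seq.
  rewrite /order_iso /= !ltnn !eqxx lt_yx [x < y]ltnNge (ltnW lt_yx).
  by rewrite (gtn_eqF lt_yx) (ltn_eqF lt_yx).
move/(contra IHw); rewrite negbK => /containsP[s sw iso_s].
by apply/containsP; exists s => //; apply: subseq_trans (subseq_cons w x).
Qed.

Lemma avoids231P (w : seq nat) :
  reflect (forall a b c, subseq [:: a; b; c] w -> c < a < b -> False)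
          (avoids [:: 2; 3; 1] w).
Proof.
apply: (iffP idP) => [av a b c sw /andP[lt_ca lt_ab]|av].
  case/containsP: av; exists [:: a; b; c] => //.
  have lt_cb := ltn_trans lt_ca lt_ab.
  rewrite /order_iso /= !ltnn !eqxx lt_ca lt_ab lt_cb.
  rewrite !(ltn_eqF lt_ca, ltn_eqF lt_ab, ltn_eqF lt_cb).
  rewrite !(gtn_eqF lt_ca, gtn_eqF lt_ab, gtn_eqF lt_cb).
  by rewrite !(leq_gtF (ltnW lt_ca), leq_gtF (ltnW lt_ab))
             (leq_gtF (ltnW lt_cb)).
apply/containsP => -[[|a [|b [|c [|d s]]]] //] /av {}av.
rewrite /order_iso /= => iso; apply: av.
by move: iso; case: (c < a); case: (a < b) => //; rewrite ?andbF.
Qed.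

(** * Stacks only rearrange their input *)

Lemma pop_until_cat (tau : seq nat) (x : nat) (st : seq nat) :
  (pop_until tau x st).1 ++ (pop_until tau x st).2 = st.
Proof.
elim: st => [|y st IHst] /=; case: ifP => // _.
by move: IHst; case: pop_until => out rest /= ->.
Qed.

Lemma stack_runE (tau st : seq nat) (x : nat) (w : seq nat) :
  stack_run tau st (x :: w) =
  (pop_until tau x st).1 ++ stack_run tau (x :: (pop_until tau x st).2) w.
Proof. by rewrite /=; case: pop_until. Qed.

Lemma perm_stack_run (tau st w : seq nat) :
  perm_eq (stack_run tau st w) (st ++ w).
Proof.
elim: w st => [|x w IHw] st; first by rewrite cats0.
rewrite stack_runE -[in st ++ _](pop_until_cat tau x st) -catA perm_cat2l.
by rewrite (perm_trans (IHw _)) // -cat1s -(cat1s x w) -catA perm_catCA.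
Qed.

Lemma perm_tau_stack (tau w : seq nat) : perm_eq (tau_stack tau w) w.
Proof. exact: perm_stack_run. Qed.

Lemma perm_cayley (v w : seq nat) :
  perm_eq v w -> (v \in cayley) = (w \in cayley).
Proof.
move=> eq_vw; rewrite !inE (perm_all _ eq_vw) (perm_big _ eq_vw) /=.
by congr (_ && _); apply: eq_all => x; rewrite /= (perm_mem eq_vw).
Qed.

(** * The two rules for the 11-stack *)

Lemma pop11_uniq (x : nat) (st : seq nat) :
  uniq (x :: (pop_until [:: 1; 1] x st).2).
Proof.
elim: st => [|y st IHst] /=; rewrite avoids11E //; case: ifP => // _.
by case: pop_until IHst.
Qed.

(** The old [m] lies at the bottom and blocks the new one until it is popped itself, which empties
    the stack. *)
Lemma pop11_last (m : nat) (st : seq nat) : uniq (rcons st m) ->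
  pop_until [:: 1; 1] m (rcons st m) = (rcons st m, [::]).
Proof.
elim: st => [|y st IHst] /=; first by rewrite !avoids11E /= inE eqxx.
by case/andP => _ u; rewrite avoids11E /= inE mem_rcons mem_head orbT /= IHst.
Qed.

(** A bottom letter occurring nowhere else creates no repetition, so it does not affect the pops. *)
Lemma pop11_rcons (m x : nat) (st : seq nat) : m \notin x :: st ->
  pop_until [:: 1; 1] x (rcons st m) =
  ((pop_until [:: 1; 1] x st).1, rcons (pop_until [:: 1; 1] x st).2 m).
Proof.
elim: st => [|y st IHst].
  by rewrite inE /= !avoids11E /= inE andbT eq_sym => ->.
move=> mxyst; have mxst : m \notin x :: st.
  by apply: contra mxyst; rewrite !inE => /orP[]->; rewrite ?orbT.
rewrite rcons_cons /= IHst // !avoids11E.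
rewrite -2!rcons_cons rcons_uniq mxyst andTb.
by case: ifP => // _; case: pop_until.
Qed.

Lemma stack_run11_cat (m : nat) (st C D : seq nat) : uniq (rcons st m) ->
  stack_run [:: 1; 1] (rcons st m) (C ++ m :: D) =
  stack_run [:: 1; 1] (rcons st m) C ++ stack_run [:: 1; 1] [:: m] D.
Proof.
elim: C st => [|x C IHC] st u; first by rewrite stack_runE pop11_last.
rewrite cat_cons !stack_runE.
have [<-|neq_xm] := eqVneq m x.
  (* [C] may contain [m] as well: such a letter flushes the stack down to [[:: m]], so the induction
     resumes with nothing above [m]. *)
  by rewrite pop11_last //= (IHC [::]) // catA.
have mst : m \notin x :: st.
  by rewrite inE negb_or neq_xm; move: u; rewrite rcons_uniq => /andP[].
have := pop11_uniq x (rcons st m).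
by rewrite pop11_rcons // -catA -rcons_cons => u'; rewrite IHC.
Qed.

Lemma stack_run11_rcons (m : nat) (st B : seq nat) : m \notin st ++ B ->
  stack_run [:: 1; 1] (rcons st m) B = rcons (stack_run [:: 1; 1] st B) m.
Proof.
elim: B st => [|x B IHB] st // mstB.
have mst : m \notin x :: st.
  apply: contra mstB; rewrite inE mem_cat inE.
  by case/orP=> ->; rewrite ?orbT.
rewrite !stack_runE pop11_rcons //= -rcons_cons IHB ?rcons_cat //.
apply: contra mstB; rewrite -[in st ++ _](pop_until_cat [:: 1; 1] x st).
rewrite cat_cons !(mem_cat, inE).
by case/or3P=> ->; rewrite ?orbT.
Qed.

Lemma tau_stack11_cons (m : nat) (w : seq nat) :
  tau_stack [:: 1; 1] (m :: w) = stack_run [:: 1; 1] [:: m] w.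
Proof. by rewrite /tau_stack /= avoids11E. Qed.

(** * The involution *)

Definition rev_stack11 (w : seq nat) : seq nat := rev (tau_stack [:: 1; 1] w).

Lemma rev_stack11_cat (m : nat) (C D : seq nat) :
  rev_stack11 ((m :: C) ++ m :: D) =
  rev_stack11 (m :: D) ++ rev_stack11 (m :: C).
Proof.
by rewrite /rev_stack11 -rev_cat !tau_stack11_cons (@stack_run11_cat m [::]).
Qed.

Lemma rev_stack11_notin (m : nat) (B : seq nat) : m \notin B ->
  rev_stack11 (m :: B) = m :: rev_stack11 B.
Proof.
move=> mB; rewrite /rev_stack11 tau_stack11_cons.
by rewrite (@stack_run11_rcons m [::]) // rev_rcons.
Qed.

Lemma perm_rev_stack11 (w : seq nat) : perm_eq (rev_stack11 w) w.
Proof. by rewrite perm_rev; apply: perm_tau_stack. Qed.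

Lemma notin_or_first_occurrence (m : nat) (w : seq nat) :
  m \notin w \/ exists B C, w = B ++ m :: C /\ m \notin B.
Proof.
have [mw|] := boolP (m \in w); last by left.
right; exists (take (index m w) w), (drop (index m w).+1 w).
by rewrite -drop_index // cat_take_drop in_take_leq ?ltnn // index_size.
Qed.

(** Reversal brings the image of the last block to the front, and a block without a further [m]
    keeps [m] first. This makes the cutting rule applicable to images. *)
Lemma rev_stack11_head (m : nat) (w : seq nat) :
  exists v, rev_stack11 (m :: w) = m :: v.
Proof.
have [n] := ubnP (size w); elim: n w => // n IHn w.
have [mw _|[B [C [-> mB]]]] := notin_or_first_occurrence m w.
  by exists (rev_stack11 w); rewrite rev_stack11_notin.
rewrite size_cat /= addnS ltnS => le_n.
have [v eqv] := IHn C (leq_ltn_trans (leq_addl _ _) le_n).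
by exists (v ++ rev_stack11 (m :: B)); rewrite -cat_cons rev_stack11_cat eqv.
Qed.

Lemma rev_stack11K : involutive rev_stack11.
Proof.
move=> w; have [n] := ubnP (size w); elim: n w => // n IHn [|m w] //=.
have [mw|[B [C [-> mB]]]] := notin_or_first_occurrence m w;
  rewrite ltnS => lt_n.
  by rewrite !rev_stack11_notin ?IHn // (perm_mem (perm_rev_stack11 w)).
rewrite -cat_cons rev_stack11_cat.
(* Both images start with [m], so the cutting rule applies a second time and restores the order of
   the blocks. *)
have [v eqv] := rev_stack11_head m C; have [u equ] := rev_stack11_head m B.
move: lt_n; rewrite size_cat /= addnS => lt_n.
rewrite equ eqv rev_stack11_cat -equ -eqv !IHn //=.
  by apply: leq_trans lt_n; rewrite !ltnS leq_addl.
by apply: leq_trans lt_n; rewrite !ltnS leq_addr.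
Qed.

(** * The 21-stack and avoidance of 231 *)

Lemma pop21_sorted (x : nat) (st : seq nat) : sorted leq st ->
  sorted leq (x :: (pop_until [:: 2; 1] x st).2).
Proof.
elim: st => [|y st IHst] st_sorted /=; rewrite avoids21E //; case: ifP => // _.
by case: pop_until (IHst (path_sorted st_sorted)).
Qed.

Lemma pop21_lt (x : nat) (st : seq nat) : sorted leq st ->
  all (gtn x) (pop_until [:: 2; 1] x st).1.
Proof.
elim: st => [|y st IHst] st_sorted /=; rewrite avoids21E //=.
move: st_sorted => /= st_sorted; rewrite st_sorted andbT.
case: leqP => // lt_yx.
case: pop_until (IHst (path_sorted st_sorted)) => out rest /= ->.
by rewrite lt_yx.
Qed.

(* The first conjunct says that [rev st ++ w] has no occurrence of 231 starting
   in the stack. *)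
Lemma stack_run21_sorted (st w : seq nat) : sorted leq st ->
  sorted leq (stack_run [:: 2; 1] st w) <->
  (forall a b c, a \in st -> subseq [:: b; c] w -> c < a < b -> False) /\
  avoids [:: 2; 3; 1] w.
Proof.
elim: w st => [|x w IHw] st st_sorted.
  by split=> // _; split=> //; apply/avoids231P.
rewrite stack_runE.
have def_st := pop_until_cat [:: 2; 1] x st.
have := pop21_sorted x st st_sorted; have /allP := pop21_lt x st st_sorted.
case: pop_until def_st => out rest /= def_st out_lt rest_sorted.
have := rest_sorted; rewrite (path_sortedE leq_trans) => /andP[/allP rest_ge _].
have run_perm := perm_stack_run [:: 2; 1] (x :: rest) w.
move: st_sorted.
(* Pairwise comparison splits sortedness of the output: [out] is sorted, the later run is sorted,
   and no letter of [out] exceeds a letter of the run. *)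
rewrite -def_st !(sorted_pairwise leq_trans) !pairwise_cat.
case/and3P => /allrelP out_rest -> _.
rewrite andTb -(sorted_pairwise leq_trans).
split=> [/andP[/allrelP out_run /IHw[] // av_st /avoids231P av_w]|[av_st av_w]].
  split=> [a b c|]; last first.
    apply/avoids231P => a b c; have [->|neq_ax] := eqVneq a x.
      by rewrite /= eqxx => /av_st; apply; apply: mem_head.
    by rewrite /= (negPf neq_ax) => /av_w.
  rewrite mem_cat => /orP[a_out|a_rest] sbc /andP[lt_ca lt_ab].
    (* Whether or not [b] is [x], the letter [c] is still to be read, hence is output after the
       popped [a], against [c < a]. *)
    have: c \in w.
      move: sbc; rewrite /=; case: eqP => _ /mem_subseq; apply;
        by rewrite ?mem_seq1 // !inE eqxx orbT.
    move=> cw; have := out_run a c a_out.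
    by rewrite (perm_mem run_perm) mem_cat cw orbT leqNgt lt_ca => /(_ isT).
  (* Letters of [rest] are at least [x], so [b] cannot be this [x]. *)
  move: sbc lt_ab => /=; case: eqP => [-> _|_ sbc lt_ab].
    by rewrite ltnNge rest_ge.
  by apply: (av_st a b c) => //; rewrite ?inE ?a_rest ?orbT ?lt_ca.
apply/andP; split.
  apply/allrelP => a c a_out; rewrite (perm_mem run_perm) mem_cat => /orP[|cw].
    rewrite inE => /orP[/eqP->|/(out_rest _ _ a_out)//].
    exact: ltnW (out_lt _ a_out).
  (* A smaller [c] read after [x] has popped [a] would make [a x c] an occurrence of 231. *)
  rewrite leqNgt; apply/negP => lt_ca; apply: (av_st a x c).
  - by rewrite mem_cat a_out.
  - by rewrite /= eqxx sub1seq.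
  - by rewrite lt_ca; apply: out_lt.
apply/IHw => //; move/avoids231P: av_w => av_w; split=> [a b c|].
  rewrite inE => /orP[/eqP->|a_rest] sbc; first by apply: av_w; rewrite /= eqxx.
  apply: av_st; first by rewrite mem_cat a_rest orbT.
  by apply: subseq_trans sbc (subseq_cons w x).
apply/avoids231P => a b c sabc; apply: av_w.
by apply: subseq_trans sabc (subseq_cons w x).
Qed.

Lemma sortable11E (w : seq nat) :
  sortable11 w = avoids [:: 2; 3; 1] (tau_stack [:: 1; 1] w).
Proof.
have [] // := @stack_run21_sorted [::] (tau_stack [:: 1; 1] w).
move=> sorted_av av_sorted; apply/idP/idP => [/sorted_av[]|av] //.
exact: av_sorted.
Qed.

(** * Bijectivity and counting *)

Lemma tau_stack11_inj : injective (tau_stack [:: 1; 1]).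
Proof.
move=> v w eq_vw; rewrite -[v]rev_stack11K -[w]rev_stack11K.
by rewrite /rev_stack11 eq_vw.
Qed.

Lemma cayley_count_tau_stack11 (n : nat) (P : pred (seq nat)) :
  cayley_count n (P \o tau_stack [:: 1; 1]) = cayley_count n P.
Proof.
(* The 11-stack transported to tuples; [inord] never takes its default value, since every output
   letter is a letter of [t]. *)
pose f (t : n.-tuple 'I_n.+1) : n.-tuple 'I_n.+1 :=
  [tuple inord (nth 0 (tau_stack [:: 1; 1] (map val t)) i) | i < n].
have perm_f (t : n.-tuple 'I_n.+1) :
    perm_eq (tau_stack [:: 1; 1] (map val t)) (map val t).
  exact: perm_tau_stack.
have val_f (t : n.-tuple 'I_n.+1) :
    map val (f t) = tau_stack [:: 1; 1] (map val t).
  have size_f : size (tau_stack [:: 1; 1] (map val t)) = n.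
    by rewrite (perm_size (perm_f t)) size_map size_tuple.
  apply: (@eq_from_nth _ 0); rewrite size_map size_tuple ?size_f // => i lt_in.
  have lt_nth : nth 0 (tau_stack [:: 1; 1] (map val t)) i < n.+1.
    have: nth 0 (tau_stack [:: 1; 1] (map val t)) i \in map val t.
      by rewrite -(perm_mem (perm_f t)) mem_nth ?size_f.
    by case/mapP => j _ ->; apply: ltn_ord.
  rewrite (nth_map ord0) ?size_tuple // -[i in LHS]/(val (Ordinal lt_in)).
  by rewrite -tnth_nth tnth_mktuple [LHS]inordK.
have f_inj : injective f.
  move=> t u eq_f; apply/val_inj/(inj_map val_inj)/tau_stack11_inj.
  by rewrite -!val_f eq_f.
(* The left-hand set is the preimage under the injection [f] of the right-hand one. *)
rewrite /cayley_count -[RHS](card_preimset _ f_inj); apply: eq_card => t.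
rewrite !in_set val_f; congr (_ && _).
by rewrite (perm_cayley _ _ (perm_f t)).
Qed.

Theorem theorem7 :
  [/\ (* R o S^11 is an involution on Cayley permutations *)
      {in cayley, forall w, (rev \o tau_stack [:: 1; 1]) w \in cayley}
      /\ {in cayley, forall w,
            (rev \o tau_stack [:: 1; 1])
              ((rev \o tau_stack [:: 1; 1]) w) = w},
      (* S^11 is a length-preserving bijection on Cayley permutations *)
      [/\ {in cayley, forall w, tau_stack [:: 1; 1] w \in cayley},
          {in cayley, forall w, size (tau_stack [:: 1; 1] w) = size w},
          {in cayley &, injective (tau_stack [:: 1; 1])}
        & {in cayley, forall v,
             exists2 w, w \in cayley & tau_stack [:: 1; 1] w = v}]
    & forall n : nat,
        cayley_count n sortable11 = cayley_count n (avoids [:: 2; 3; 1])].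
Proof.
split; [split=> w cw | split=> [w cw|w cw|v w _ _|v cv] | move=> n].
- by rewrite (perm_cayley _ _ (perm_rev_stack11 w)).
- exact: rev_stack11K.
- by rewrite (perm_cayley _ _ (perm_tau_stack _ w)).
- exact: perm_size (perm_tau_stack _ w).
- exact: tau_stack11_inj.
(* The equation $\mathcal{S}^{11}(w)=v$ says that the involution sends [w] to [rev v], so [w] is the
   image of [rev v]. *)
- exists (rev_stack11 (rev v)); last first.
    by apply: (can_inj revK); apply: rev_stack11K.
  rewrite (perm_cayley _ v) // (perm_trans (perm_rev_stack11 _)) //.
  by rewrite perm_rev.
rewrite -[RHS]cayley_count_tau_stack11; apply: eq_card => t.
by rewrite !in_set sortable11E.
Qed.
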